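(* Let $\mathcal{H}=(V,E)$ be a hypergraph with co-rank $s$, $|V|=n$, average degree $d(\mathcal{H})$ and adjacency matrix $\mathbf{A}$. Then $$\mathcal{E}(\mathcal{H})\ge\sqrt{n(s-1)d(\mathcal{H})+n(n-1)|\det(\mathbf{A})|^{2/n}}.$$
   Context: A hypergraph $\mathcal{H}=(V,E)$ consists of a finite vertex set $V$ and a set $E$ of edges, each edge being a subset of $V$ of cardinality at least $2$ (distinct edges are distinct subsets). The co-rank of $\mathcal{H}$ is the smallest cardinality of an edge. For $\alpha\subseteq V$, $d(\alpha)$ is the number of edges containing all vertices of $\alpha$; the degree of $v$ is $d(v)=d(\{v\})$ and $d(\mathcal{H})=\frac1{|V|}\sum_v d(v)$. The adjacency matrix $\mathbf{A}=\mathbf{A}(\mathcal{H})$ is the $n\times n$ matrix with zero diagonal and $(i,j)$ entry $d(\{i,j\})$ for $i\neq j$. The energy is $\mathcal{E}(\mathcal{H})=\sum_{i=1}^n|\lambda_i|$, where $\lambda_1,\dots,\lambda_n$ are the eigenvalues of $\mathbf{A}$. *)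

(* Defs.v *)
From mathcomp Require Import all_boot all_order all_algebra.
From mathcomp.real_closed Require Export complex.
From mathcomp Require Export reals exp.

Set Implicit Arguments.
Unset Strict Implicit.
Unset Printing Implicit Defensive.

Import Order.TTheory GRing.Theory Num.Theory.
Local Open Scope ring_scope.

Record hypergraph (V : finType) := Hypergraph {
  edges : {set {set V}};
  edge_card : forall e, e \in edges -> (2 <= #|e|)%N
}.

(* The minimum starts from the upper bound #|V| on all edge cardinalities;
   this starting value is returned only when the minimum is #|V| or when there
   are no edges. *)
Definition corank (V : finType) (H : hypergraph V) : nat :=
  \big[minn/#|V|]_(e in edges H) #|e|.

Lemma corank_le (V : finType) (H : hypergraph V) e :
  e \in edges H -> (corank H <= #|e|)%N.
Proof.
move=> eH; rewrite /corank; have := mem_index_enum e.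
elim: (index_enum _) => //= f r IHr; rewrite inE big_cons.
case/orP=> [/eqP <-|/IHr le_r]; first by rewrite eH geq_minl.
by case: ifP => // _; rewrite geq_min le_r orbT.
Qed.

Lemma corank_attained (V : finType) (H : hypergraph V) :
  edges H != set0 -> exists2 e, e \in edges H & corank H = #|e|.
Proof.
case/set0Pn=> e0 e0H.
have [//|cV] : (exists2 e, e \in edges H & corank H = #|e|) \/ corank H = #|V|.
  rewrite /corank; elim/big_ind: _ => [|x y xP yP|e eH]; first by right.
    by case: (leqP x y).
  by left; exists e.
exists e0 => //; apply/eqP; rewrite eqn_leq corank_le //= cV.
exact: max_card.
Qed.

Definition codegree (V : finType) (H : hypergraph V) (a : {set V}) : nat :=
  #|[set e in edges H | a \subset e]|.

Definition degree (V : finType) (H : hypergraph V) (v : V) : nat :=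
  codegree H [set v].

Section Energy.
Variable R : realType.

Definition avg_degree (V : finType) (H : hypergraph V) : R :=
  (\sum_(v : V) (degree H v)%:R) / #|V|%:R.

(* Rows and columns are indexed by the vertices through the enumeration of V. *)
Definition adjmx (V : finType) (H : hypergraph V) : 'M[R]_#|V| :=
  \matrix_(i, j) if i == j then 0
                 else (codegree H [set enum_val i; enum_val j])%:R.

(* The complex roots of the characteristic polynomial, listed with their
   multiplicities. *)
Definition eigenvalues (n : nat) (A : 'M[R]_n) : seq R[i] :=
  sval (closed_field_poly_normal (char_poly (map_mx (real_complex R) A))).

Lemma char_poly_eigenvalues (n : nat) (A : 'M[R]_n) :
  char_poly (map_mx (real_complex R) A) =
  \prod_(z <- eigenvalues A) ('X - z%:P).
Proof.
rewrite /eigenvalues; case: closed_field_poly_normal => r /= {1}->.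
by rewrite (monicP (char_poly_monic _)) scale1r.
Qed.

(* The norm of R[i] takes its values in R[i], on the real axis; Re reads it
   in R. *)
Definition energy (V : finType) (H : hypergraph V) : R :=
  \sum_(z <- eigenvalues (adjmx H)) complex.Re `|z|.

End Energy.

(* Main.v *)
(** With [S = sum |z_i|] over the eigenvalues, [S^2] is the sum of the diagonal
    part [sum |z_i|^2], which is at least [|sum z_i^2| = tr (A^2)], and of the
    off-diagonal part [sum_(i != j) |z_i| |z_j|], to which AM-GM applies with
    the product of its [n (n - 1)] terms equal to [|det A|^(2 (n - 1))].  Since
    the entries of [A] are natural numbers, [tr (A^2)] is at least the sum of
    the entries, which counts [|e| - 1 >= s - 1] for each incidence of a vertex
    with an edge [e].  The symmetry of [A] is only used to get
    [tr (A^2) = sum A_ij^2]: the eigenvalues need not be known to be real. *)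
Require Import Defs.
From mathcomp Require Import all_boot all_order all_algebra.
From mathcomp Require Import reals exp.
From mathcomp Require Import mxred spectral.

Import Order.TTheory GRing.Theory Num.Theory.
Local Open Scope ring_scope.

Lemma char_poly_conj {R : comUnitRingType} {n : nat} (P A : 'M[R]_n) :
  P \in unitmx -> char_poly (P *m A *m invmx P) = char_poly A.
Proof.
move=> uP; rewrite /char_poly.
have -> : char_poly_mx (P *m A *m invmx P) =
    map_mx polyC P *m char_poly_mx A *m map_mx polyC (invmx P).
  rewrite /char_poly_mx mulmxBr mulmxBl mul_mx_scalar -scalemxAl -map_mxM mulmxV //.
  by rewrite !map_mxM /= map_scalar_mx scalemx1.
rewrite !det_mulmx mulrC mulrA -det_mulmx -map_mxM mulVmx //.
by rewrite map_scalar_mx det1 mul1r.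
Qed.

Lemma mxtrace_sqr_trig {R : comPzRingType} {n : nat} (T : 'M[R]_n) :
  is_trig_mx T -> \tr (T *m T) = \sum_i T i i ^+ 2.
Proof.
move=> /is_trig_mxP trigT; apply: eq_bigr => i _; rewrite mxE (bigD1 i) //=.
rewrite big1 ?addr0 // => j neq_ji; case: (ltngtP i j) => [ltij|ltji|eqij].
- by rewrite trigT ?mul0r.
- by rewrite (trigT j i) ?mulr0.
- by rewrite (val_inj eqij) eqxx in neq_ji.
Qed.

(** Schur triangularization: the diagonal of a triangular conjugate of [A] lists the roots of the
    characteristic polynomial, while traces and determinants are invariant under conjugation. *)
Lemma spectrum_trace_det {C : numClosedFieldType} {n : nat} (A : 'M[C]_n)
    (r : seq C) :
  char_poly A = \prod_(z <- r) ('X - z%:P) ->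
  exists t : 'I_n -> C,
    [/\ perm_eq r [seq t i | i <- index_enum 'I_n],
        \sum_i t i ^+ 2 = \tr (A *m A) & \prod_i t i = \det A].
Proof.
move=> charA.
have [P uP trigT] : exists2 P, P \in unitmx & is_trig_mx (P *m A *m invmx P).
  (* [Schur] requires a positive size, so the empty matrix is treated apart. *)
  case: n A {charA} => [|n] A.
    by exists 1%:M; rewrite ?unitmx1 //; apply/is_trig_mxP; case.
  have [//|P unitaryP] := Schur A.
  have uP := unitarymx_unit unitaryP.
  by rewrite /similar_to /= conjumx //; exists P.
set T := P *m A *m invmx P in trigT.
exists (fun i => T i i); split.
- apply: prod_XsubC_eq; rewrite -charA -(char_poly_conj P A uP) big_map.
  by rewrite char_poly_trig.
- rewrite -mxtrace_sqr_trig // /T -!mulmxA mulKmx // mxtrace_mulC.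
  by rewrite -!mulmxA mulVmx // mulmx1.
- by rewrite -det_trig // /T !det_mulmx mulrAC -det_mulmx mulmxV // det1 mul1r.
Qed.

(** Each index occurs [n.-1] times as a first coordinate and [n.-1] times as a second one. *)
Lemma prod_off_diagonal {R : comPzSemiRingType} {n : nat} (x : 'I_n -> R) :
  \prod_(p : 'I_n * 'I_n | p.1 != p.2) (x p.1 * x p.2)
  = (\prod_i x i) ^+ (2 * n.-1).
Proof.
have constE i (P : pred 'I_n) (a : R) : P =1 [in predC1 i] ->
    \prod_(j | P j) a = a ^+ n.-1.
  by move=> eqP; rewrite (eq_bigl _ _ eqP) prodr_const cardC1 card_ord.
rewrite -(pair_big_dep xpredT (fun i j => i != j) (fun i j => x i * x j)) /=.
under eq_bigr do rewrite big_split /=.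
rewrite big_split /= [X in _ * X](exchange_big_dep xpredT) //= -big_split /=.
rewrite -prodrXl; apply: eq_bigr => i _.
rewrite !(constE i) ?mul2n -?addnn ?exprD // => j.
by rewrite !inE eq_sym.
Qed.

Lemma card_off_diagonal (n : nat) :
  #|[pred p : 'I_n * 'I_n | p.1 != p.2]| = (n * n.-1)%N.
Proof.
rewrite -sum1_card -(pair_big_dep xpredT (fun i j => i != j) (fun _ _ => 1%N)).
rewrite /= (eq_bigr (fun _ => n.-1)) ?sum_nat_const ?card_ord // => i _.
rewrite sum1_card -[n in RHS]card_ord -(cardC1 i); apply: eq_card => j.
by rewrite !inE eq_sym.
Qed.

Lemma sum_off_diagonal_ge {R : realType} {n : nat} (x : 'I_n -> R) :
  (forall i, 0 <= x i) ->
  n%:R * (n%:R - 1) * (\prod_i x i) `^ (2 / n%:R)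
  <= \sum_(p : 'I_n * 'I_n | p.1 != p.2) x p.1 * x p.2.
Proof.
move=> x0; set S := \sum_(p | _) _.
have S0 : 0 <= S by apply: sumr_ge0 => p _; apply: mulr_ge0.
(* For [n <= 1] there are no off-diagonal pairs to average over, but the factor [n (n - 1)]
   vanishes. *)
case: (leqP n 1) => [n_le1|n_gt1].
  suff -> : n%:R * (n%:R - 1) = 0 :> R by rewrite mul0r.
  by case: n n_le1 {x x0 S S0} => [|[|]] // _; rewrite ?mul0r // subrr mulr0.
set g := _ `^ _; set M := (n * n.-1)%N.
have M0 : (0 < M)%N by rewrite /M muln_gt0 -subn1 subn_gt0 n_gt1 ltnW.
have -> : n%:R * (n%:R - 1) = M%:R :> R.
  by rewrite natrM -subn1 natrB // ltnW.
have g0 : 0 <= g by apply: powR_ge0.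
(* Since [(2 / n) * n (n - 1) = 2 (n - 1)], [g] is the geometric mean of the [M] off-diagonal
   products. *)
have gM : g ^+ M = (\prod_i x i) ^+ (2 * n.-1).
  rewrite -powR_mulrn // -powRrM -powR_mulrn ?prodr_ge0 //; congr (_ `^ _).
  have n0 : n%:R != 0 :> R by rewrite pnatr_eq0 -lt0n ltnW.
  by rewrite /M !natrM mulrA divfK.
have [] := @leif_AGM R _ [pred p : 'I_n * 'I_n | p.1 != p.2]
  (fun p => x p.1 * x p.2) _.
  by move=> p _; apply: mulr_ge0.
rewrite card_off_diagonal -/M prod_off_diagonal -gM => le_pow _.
rewrite mulrC -ler_pdivlMr ?ltr0n //.
by rewrite -(ler_pXn2r M0) // nnegrE ?divr_ge0.
Qed.

Lemma norm_real_complex {R : rcfType} (x : R) : `|x|%:C%C = `|x%:C%C|.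
Proof. by rewrite normc_def /= expr0n addr0 sqrtr_sqr. Qed.

Lemma energy_sqr_ge {R : realType} {n : nat} (A : 'M[R]_n) :
  \tr (A *m A) + n%:R * (n%:R - 1) * `|\det A| `^ (2 / n%:R)
  <= (\sum_(z <- eigenvalues A) complex.Re `|z|) ^+ 2.
Proof.
have [t [perm_t tr_t det_t]] := spectrum_trace_det _ _ (char_poly_eigenvalues A).
rewrite (perm_big _ perm_t) big_map.
pose x i := complex.Re `|t i|.
(* The moduli are real, so taking [Re] loses nothing and inequalities can be checked in [R[i]]. *)
have xE i : (x i)%:C%C = `|t i| by apply: RRe_real; apply: normr_real.
have x0 i : 0 <= x i by rewrite -lecR xE; apply: normr_ge0.
rewrite -[X in X ^+ 2]/(\sum_i x i) expr2 big_distrlr /= pair_big /=.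
rewrite (bigID (fun p : 'I_n * 'I_n => p.1 == p.2)) /= lerD //.
  rewrite -(pair_big_dep xpredT (fun i j => i == j) (fun i j => x i * x j)) /=.
  rewrite (eq_bigr (fun i => x i * x i)) => [|i _]; last first.
    by apply: big_pred1 => j; rewrite eq_sym.
  apply: le_trans (ler_norm _) _; rewrite -lecR norm_real_complex.
  rewrite -trace_map_mx map_mxM -tr_t rmorph_sum; apply: le_trans (ler_norm_sum _ _ _) _.
  by apply: ler_sum => i _; rewrite rmorphM /= xE normrX.
have -> : `|\det A| = \prod_i x i.
  apply: complexI; rewrite norm_real_complex -det_map_mx -det_t normr_prod rmorph_prod.
  by apply: eq_bigr => i _; rewrite /= xE.
exact: sum_off_diagonal_ge.
Qed.

(** Double counting of the pairs [(w, e)] with [w != v] and both vertices in [e]. *)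
Lemma sum_codegree {V : finType} (H : hypergraph V) (v : V) :
  (\sum_(w | w != v) codegree H [set v; w]
   = \sum_(e in edges H | v \in e) #|e|.-1)%N.
Proof.
under eq_bigr do rewrite /codegree -sum1dep_card.
rewrite (exchange_big_dep (fun e => (e \in edges H) && (v \in e))) /=.
  apply: eq_bigr => e /andP[eH ve]; rewrite sum1dep_card (cardsD1 v e) ve /=.
  apply: eq_card => w; rewrite !inE eH subUset !sub1set ve.
  by rewrite eq_sym.
by move=> w e _ /andP[-> /subsetP-> //]; rewrite !inE eqxx.
Qed.

Lemma corank_degree_le {V : finType} (H : hypergraph V) (v : V) :
  ((corank H).-1 * degree H v <= \sum_(w | w != v) codegree H [set v; w])%N.
Proof.
rewrite sum_codegree /degree /codegree mulnC -sum_nat_cond_const.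
rewrite [leqLHS](eq_bigl (fun e => (e \in edges H) && (v \in e))) => [|e].
  by apply: leq_sum => e /andP[/corank_le + _]; rewrite -!subn1 => /leq_sub2r.
by rewrite sub1set.
Qed.

Lemma mxtrace_sqr_adjmx_ge {R : realType} {V : finType} (H : hypergraph V) :
  ((\sum_v (corank H).-1 * degree H v)%N)%:R
  <= \tr (adjmx R H *m adjmx R H).
Proof.
have -> : \tr (adjmx R H *m adjmx R H)
    = (\sum_v \sum_(w | w != v) codegree H [set v; w] ^ 2)%N%:R.
  rewrite natr_sum (reindex _ (onW_bij _ (enum_val_bij V))) /=.
  apply: eq_bigr => i _; rewrite !mxE natr_sum.
  rewrite (reindex _ (onW_bij _ (enum_val_bij V))) /= [RHS]big_mkcond /=.
  apply: eq_bigr => j _; rewrite !mxE (inj_eq enum_val_inj) (eq_sym j i).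
  by case: eqP => _ /=; rewrite ?mul0r // setUC natrX.
rewrite ler_nat; apply: leq_sum => v _; apply: leq_trans (corank_degree_le H v) _.
(* A natural number is at most its square. *)
by apply: leq_sum => w _; rewrite -mulnn; case: codegree => // k; apply: leq_pmulr.
Qed.

Theorem theorem31 (R : realType) (V : finType) (H : hypergraph V) (n s : nat)
    (hn : #|V| = n) (hs : corank H = s) :
  Num.sqrt (n%:R * (s%:R - 1) * avg_degree R H
            + n%:R * (n%:R - 1) * `|\det (adjmx R H)| `^ (2 / n%:R))
  <= energy R H.
Proof.
have energy0 : 0 <= energy R H.
  apply: sumr_ge0 => z _; rewrite -lecR RRe_real ?normr_real //.
  exact: normr_ge0.
rewrite -(ger0_norm energy0) -(sqrtr_sqr (energy R H)); apply: ler_wsqrtr.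
apply: le_trans (energy_sqr_ge _); subst n s; rewrite lerD2r.
apply: le_trans (mxtrace_sqr_adjmx_ge H).
rewrite /avg_degree -big_distrr /= natrM -natr_sum.
(* The factor [n] cancels the denominator of the average degree only when [V] is nonempty; otherwise
   it makes the left side zero. *)
have [V0|V0] := posnP #|V|; first by rewrite V0 !mul0r mulr_ge0.
rewrite mulrAC mulrCA mulfV ?pnatr_eq0 -?lt0n // mulr1 mulrC.
rewrite ler_wpM2r ?ler0n // lerBlDr natr1 ler_nat.
(* The predecessor is truncated at zero, so [s - 1 <= s.-1] holds in [R] even for [s = 0]. *)
exact: leqSpred.
Qed.
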